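(* Let $t,u\in\mathbb{R}$ satisfy $t\notin\{0,1\}$, $u\notin\{0,1,-1\}$, $2u\ne t+1$, $tu+u\ne2$, $D_F(t,u)\ne0$ and $V_F(t,\omega(u))>0$. Then $\mathfrak{g}_{t,u}\in\mathcal{E}(\mathcal{P}_{4,4})$.
   Context: Variables $a,b,c,d$. Put $s_0=a^4+b^4+c^4+d^4-4abcd$; $s_1=T_{3,1}-12abcd$ with $T_{3,1}=\sum_{i\ne j}x_i^3x_j$; $s_2=\sum_{i<j}x_i^2x_j^2-6abcd$; $s_3=T_{2,1,1}-12abcd$ with $T_{2,1,1}=\sum_i x_i^2\sum_{j<k,\ j,k\ne i}x_jx_k$; $s_4=abcd$ (here $(x_1,x_2,x_3,x_4)=(a,b,c,d)$). Let $\omega(u)=u+\frac1u-2$ and $p^G_0(t,w)=(4t+2)w^2-3(t-1)^2w$, $p^G_1(t,w)=-2(t+1)^2w^2+2(t+1)(t-1)^2w$, $p^G_2(t,w)=4t^2w^2-2(t-1)^2(2t-1)w+2(t-1)^4$, $p^G_3(t,w)=2(t+1)^2w^2-(t-1)^2(t^2+3)w-2(t-1)^4$, $p^G_4(t,w)=2(t-1)^4w^2$, and for $u\ne0$, $\mathfrak{g}_{t,u}=u^2\sum_{i=0}^4p^G_i(t,\omega(u))s_i$. Let $V_F(t,w)=(3+6t-t^2)w^2-6(t-1)^2w$ and $D_F(t,u)=(3+6t-t^2)-(13+6t+5t^2)u+(10+9t+4t^2+t^3)u^2-(1+6t+t^2)u^3$. $\mathcal{P}_{4,4}$ is the cone of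 real quartic forms in $a,b,c,d$ nonnegative on $\mathbb{R}^4$; $f\in\mathcal{P}_{4,4}\setminus\{0\}$ is extremal ($f\in\mathcal{E}(\mathcal{P}_{4,4})$) if $f=g+h$ with $g,h\in\mathcal{P}_{4,4}$ forces $g,h\in\mathbb{R}_{\ge0}f$. *)

(* Defs.v *)
From HB Require Import structures.
From mathcomp Require Import all_boot all_order all_algebra.
From mathcomp Require Import mpoly.
From mathcomp Require Import reals.

Set Implicit Arguments.
Unset Strict Implicit.
Unset Printing Implicit Defensive.

Import Order.TTheory GRing.Theory Num.Theory.
Local Open Scope ring_scope.

Section Quartics.
Variable R : realType.

Definition xv (i : 'I_4) : {mpoly R[4]} := 'X_i.

Definition abcd : {mpoly R[4]} := \prod_(i < 4) xv i.

Definition T31 : {mpoly R[4]} :=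
  \sum_(i < 4) \sum_(j < 4 | j != i) xv i ^+ 3 * xv j.

Definition T22 : {mpoly R[4]} :=
  \sum_(i < 4) \sum_(j < 4 | (i < j)%N) xv i ^+ 2 * xv j ^+ 2.

Definition T211 : {mpoly R[4]} :=
  \sum_(i < 4) xv i ^+ 2 *
     \sum_(j < 4) \sum_(k < 4 | [&& (j < k)%N, j != i & k != i]) xv j * xv k.

Definition s0 : {mpoly R[4]} := \sum_(i < 4) xv i ^+ 4 - 4%:R *: abcd.
Definition s1 : {mpoly R[4]} := T31 - 12%:R *: abcd.
Definition s2 : {mpoly R[4]} := T22 - 6%:R *: abcd.
Definition s3 : {mpoly R[4]} := T211 - 12%:R *: abcd.
Definition s4 : {mpoly R[4]} := abcd.

Definition omega (u : R) : R := u + u^-1 - 2.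

Definition pG0 (t w : R) : R := (4 * t + 2) * w ^+ 2 - 3 * (t - 1) ^+ 2 * w.
Definition pG1 (t w : R) : R :=
  - 2 * (t + 1) ^+ 2 * w ^+ 2 + 2 * (t + 1) * (t - 1) ^+ 2 * w.
Definition pG2 (t w : R) : R :=
  4 * t ^+ 2 * w ^+ 2 - 2 * (t - 1) ^+ 2 * (2 * t - 1) * w + 2 * (t - 1) ^+ 4.
Definition pG3 (t w : R) : R :=
  2 * (t + 1) ^+ 2 * w ^+ 2 - (t - 1) ^+ 2 * (t ^+ 2 + 3) * w - 2 * (t - 1) ^+ 4.
Definition pG4 (t w : R) : R := 2 * (t - 1) ^+ 4 * w ^+ 2.

Definition gtu (t u : R) : {mpoly R[4]} :=
  let w := omega u in
  (u ^+ 2) *: (pG0 t w *: s0 + pG1 t w *: s1 + pG2 t w *: s2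
               + pG3 t w *: s3 + pG4 t w *: s4).

Definition VF (t w : R) : R := (3 + 6 * t - t ^+ 2) * w ^+ 2 - 6 * (t - 1) ^+ 2 * w.

Definition DF (t u : R) : R :=
  (3 + 6 * t - t ^+ 2) - (13 + 6 * t + 5 * t ^+ 2) * u
  + (10 + 9 * t + 4 * t ^+ 2 + t ^+ 3) * u ^+ 2 - (1 + 6 * t + t ^+ 2) * u ^+ 3.

Definition P44 (f : {mpoly R[4]}) : Prop :=
  f \is 4.-homog /\ forall v : 'I_4 -> R, 0 <= f.@[v].

Definition extremal_P44 (f : {mpoly R[4]}) : Prop :=
  [/\ P44 f, f != 0 &
      forall g h : {mpoly R[4]}, P44 g -> P44 h -> f = g + h ->
        (exists2 c : R, 0 <= c & g = c *: f) /\
        (exists2 c : R, 0 <= c & h = c *: f)].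

End Quartics.

(* Main.v *)
Require Import Defs.
From HB Require Import structures.
From mathcomp Require Import all_boot all_order all_algebra.
From mathcomp Require Import mpoly.
From mathcomp Require Import reals.
From mathcomp Require Import ring lra zify.
Import Order.TTheory GRing.Theory Num.Theory.
Local Open Scope ring_scope.

(* In the coordinates (a,b,c,d) = (m+p+q+s, m+p-q-s, m-p+q-s, m-p-q+s) the form
   g_{t,u} reads k (A S - B m^2)^2 + e m pqs + f N, where S = p^2+q^2+s^2 and
   N = p^2q^2+p^2s^2+q^2s^2.

   Nonnegativity.  Fix m and S = 3 v^2.  The pair (pqs, N) then stays in the
   triangle whose vertices come from (p,q,s) = (v,v,v), (-v,-v,-v) and
   (sqrt 3 v,0,0), and g is affine in that pair.  At the third vertex g is
   k (A S - B m^2)^2; the other two vertices are points (x,y,y,y), where g is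
   u^2 (x - t y)^2 times a binary quadratic form that V_F > 0 makes positive.

   Extremality.  g vanishes at the six permutations of (u,u,1,1) and at the four
   of (t,1,1,1), so any summand g' of g in the cone is singular there.  Subtract
   the multiple of g that agrees with g' at (1,1,1,1).  The difference vanishes
   on the lines (x,x,y,y), which kills its coefficients involving at most one of
   p, q, s; the rest is determined by the remaining singularity conditions, split
   by the characters of the even sign changes of (p,q,s). *)

(** * Zeros of nonnegative polynomials are singular points *)

Section Singular.
Context {R : realFieldType}.

Lemma horner_bounded (q : {poly R}) :
  exists2 C, 0 <= C & forall e, `|e| <= 1 -> `|q.[e]| <= C.
Proof.
elim/poly_ind: q => [|q c [C C0 IH]].
  by exists 0 => // e _; rewrite horner0 normr0.
exists (C + `|c|) => [|e he]; first by rewrite addr_ge0.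
rewrite hornerMXaddC (le_trans (ler_normD _ _)) // lerD2r normrM.
by rewrite -[leRHS]mulr1 ler_pM // IH.
Qed.

(** If [d != 0], a small [e] of sign opposite to [d] lets the linear term outweigh the bounded
    remainder. *)
Lemma linear_coef_eq0 (d : R) (q : {poly R}) :
  (forall e, 0 <= e * d + e ^+ 2 * q.[e]) -> d = 0.
Proof.
move=> H; have [C C0 bq] := horner_bounded q.
apply/eqP/negPn/negP => d0.
have nd : 0 < `|d| by rewrite normr_gt0.
(* This [s] gives both [s * |d| <= 1], so that the bound [C] applies at [e = - (d * s)], and
   [s * C < 1], so that the expression, equal to [d ^+ 2 * s * (s * q.[e] - 1)], is negative. *)
pose s := (C + `|d| + 1)^-1.
have s0 : 0 < s by rewrite invr_gt0; lra.
have es : s * (C + `|d| + 1) = 1 by rewrite mulVf //; lra.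
have he : `|- (d * s)| <= 1.
  rewrite normrN normrM (gtr0_norm s0) mulrC -es ler_pM2l //; lra.
have := H (- (d * s)); have := bq _ he; rewrite ler_norml => /andP[_].
move: (q.[_]) => y hy h.
have d2 : 0 < d ^+ 2 by rewrite lt0r sqrf_eq0 d0 sqr_ge0.
have h1 : d ^+ 2 * s * (s * y - 1) >= 0.
  by apply: le_trans h _; rewrite le_eqVlt; apply/orP; left; apply/eqP; ring.
have h2 : s * y <= s * C by rewrite ler_pM2l.
have h3 : s * C < 1 by rewrite -es ltr_pM2l //; lra.
have h4 : 0 < d ^+ 2 * s by rewrite mulr_gt0.
by move: h1; rewrite pmulr_rge0 //; lra.
Qed.

(** Such first-order expansions are stable under sums and products and exist for constants and
    variables, hence for all polynomials. *)
Lemma meval_taylor n (P : {mpoly R[n]}) (z : 'I_n -> R) (i : 'I_n) :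
  exists q : {poly R}, forall e : R,
    P.@[fun j => z j + e * (j == i)%:R] =
    P.@[z] + e * (P^`M(i)).@[z] + e ^+ 2 * q.[e].
Proof.
pose T P := exists q : {poly R}, forall e : R,
    P.@[fun j => z j + e * (j == i)%:R] =
    P.@[z] + e * (P^`M(i)).@[z] + e ^+ 2 * q.[e].
have TD A B : T A -> T B -> T (A + B).
  move=> [q hq] [r hr]; exists (q + r) => e.
  rewrite !mevalD hq hr mderivD mevalD hornerD; ring.
have TM A B : T A -> T B -> T (A * B).
  move=> [q hq] [r hr].
  exists (((A^`M(i)).@[z] * (B^`M(i)).@[z])%:P + A.@[z]%:P * r + B.@[z]%:P * q
    + 'X * ((A^`M(i)).@[z]%:P * r + (B^`M(i)).@[z]%:P * q) + 'X^2 * q * r) => e.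
  rewrite !mevalM hq hr mderivM mevalD !mevalM !hornerE; ring.
have TC c : T c%:MP.
  by exists 0 => e; rewrite !mevalC mderivC meval0 horner0 !mulr0 !addr0.
have TX j : T 'X_j.
  exists 0 => e; rewrite !mevalXU mderivX horner0 mulr0 addr0 mevalZ mnm1E.
  have [->|_] := eqVneq j i; last by rewrite mul0r.
  rewrite mul1r (_ : (U_(i) - U_(i) = 0)%MM) ?mpolyX0 ?meval1 //.
  by apply/mnmP => k; rewrite mnmBE mnm0E subnn.
have TXm m : T 'X_[m].
  rewrite mpolyXE_id; elim/big_ind: _ => [|A B|j _]; first 1 last.
  - exact: TM.
  - elim: (m j) => [|k IH]; first by rewrite expr0 -mpolyC1; exact: TC.
    by rewrite exprS; apply: TM.
  by rewrite -mpolyC1; exact: TC.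
suff : T P by [].
rewrite [P]mpolyE; elim/big_ind: _ => [|A B|m _]; first 1 last.
- exact: TD.
- by rewrite -mul_mpolyC; apply: TM.
by rewrite -mpolyC0; exact: TC.
Qed.

Lemma singular_of_ge0 {n} (P : {mpoly R[n]}) (z : 'I_n -> R) :
  (forall v, 0 <= P.@[v]) -> P.@[z] = 0 -> forall i, (P^`M(i)).@[z] = 0.
Proof.
move=> P0 Pz i; have [q hq] := meval_taylor n P z i.
apply: (@linear_coef_eq0 _ q) => e.
by have := P0 (fun j => z j + e * (j == i)%:R); rewrite hq Pz add0r.
Qed.

End Singular.

(** * Quartic forms in four variables through their coefficients *)

Definition pt {R : realFieldType} (m p q s : R) : 'I_4 -> R :=
  fun i => [:: m; p; q; s]`_i.

Definition mon (e : seq nat) : 'X_{1..4} := [multinom nth 0%N e i | i < 4].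

(** Stored as a literal list of the 35 exponent vectors, so that filters and sums over it reduce by
    computation. *)
Definition exps : seq (seq nat) := Eval vm_compute in
  [seq e <- [seq [:: x.1.1; x.1.2; x.2.1; x.2.2] |
     x <- allpairs pair (allpairs pair (iota 0 5) (iota 0 5))
                        (allpairs pair (iota 0 5) (iota 0 5))] | sumn e == 4%N].

Lemma mem_exps (m : 'X_{1..4}) : mdeg m = 4%N ->
  exists2 e, e \in exps & m = mon e.
Proof.
rewrite mdegE !big_ord_recl big_ord0 /= => h.
exists [:: m 0; m 1; m 2; m 3].
  have: all (fun a => all (fun b => all (fun c => all (fun d =>
     (a + b + c + d == 4)%N ==> ([:: a; b; c; d] \in exps)) (iota 0 5))
     (iota 0 5)) (iota 0 5)) (iota 0 5) by vm_compute.
  have e1 : lift ord0 ord0 = 1 :> 'I_4 by apply/val_inj.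
  have e2 : lift ord0 (lift ord0 ord0) = 2 :> 'I_4 by apply/val_inj.
  have e3 : lift ord0 (lift ord0 (lift ord0 ord0)) = 3 :> 'I_4 by apply/val_inj.
  have e0 : ord0 = 0 :> 'I_4 by apply/val_inj.
  move: h; rewrite e1 e2 e3 e0.
  move: (m 0) (m 1) (m 2) (m 3) => a b c d h.
  have lt5 k : (k <= 4)%N -> k \in iota 0 5 by rewrite mem_iota.
  rewrite addn0 !addnA in h.
  have [[ha hb] [hc hd]] :
    ((a <= 4)%N /\ (b <= 4)%N) /\ ((c <= 4)%N /\ (d <= 4)%N) by lia.
  move=> /allP H; have {H} /allP H := H a (lt5 a ha).
  have {H} /allP H := H b (lt5 b hb); have {H} /allP H := H c (lt5 c hc).
  by have := H d (lt5 d hd); rewrite h eqxx.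
apply/mnmP => i; rewrite mnmE.
by case: i => -[|[|[|[|//]]]] hi /=; congr (m _); apply/val_inj.
Qed.

Lemma quarticE {R : realFieldType} (K : {mpoly R[4]}) : K \is 4.-homog ->
  K = \sum_(e <- exps) K@_(mon e) *: 'X_[mon e].
Proof.
move=> hK; apply/mpolyP => m.
rewrite raddf_sum /=.
under eq_bigr do rewrite mcoeffZ mcoeffX.
have [hm|hm] := eqVneq (mdeg m) 4%N; last first.
  rewrite (dhomog_nemf_coeff hK hm) big_seq big1 // => e he.
  have [E|_] := eqVneq; last by rewrite mulr0.
  move: hm; rewrite -E mdegE !big_ord_recl big_ord0 !mnmE /=.
  move=> /negP[]; move: e he {E}; exact/allP.
have [e he E] := mem_exps m hm.
(* [mon] reads only four entries, with default 0; it is injective here because all lists in [exps]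
   have length 4. *)
have inj e' : e' \in exps -> mon e' = m -> e' = e.
  move=> he' E'; have : mon e' = mon e by rewrite E'.
  move/mnmP => h.
  have sz x : x \in exps -> size x = 4%N.
    by move=> hx; apply/eqP; move: x hx; apply/allP.
  apply: (@eq_from_nth _ 0%N); first by rewrite !sz.
  move=> i; rewrite sz // => hi; have := h (Ordinal hi).
  by rewrite !mnmE.
rewrite (bigD1_seq e) //= big_seq_cond big1 ?addr0.
  by rewrite E eqxx mulr1.
move=> e' /andP[he' ne]; case: eqVneq => [E'|_]; last by rewrite mulr0.
by move: ne; rewrite (inj _ he' E') eqxx.
Qed.

(** Truncation of [.-1] at exponent 0 is harmless: [dmon] carries that exponent as a factor. *)
Definition dexp (i : nat) (e : seq nat) (j : nat) : nat :=
  if i == j then (nth 0 e j).-1 else nth 0 e j.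

Definition dmon {R : realFieldType} (e : seq nat) (i : nat) (m p q s : R) : R :=
  (nth 0%N e i)%:R *
  (m ^+ dexp i e 0 * (p ^+ dexp i e 1 * (q ^+ dexp i e 2 * s ^+ dexp i e 3))).

Lemma quartic_mderiv {R : realFieldType} (K : {mpoly R[4]}) (i : 'I_4) m p q s :
  K \is 4.-homog ->
  (K^`M(i)).@[pt m p q s] = \sum_(e <- exps) K@_(mon e) * dmon e i m p q s.
Proof.
move=> hK.
rewrite [in LHS](quarticE K hK) (big_morph _ (mderivD i) (mderiv0 _ i)).
rewrite (big_morph _ (mevalD _) (meval0 _)); apply: eq_bigr => e _.
rewrite mderivZ mderivX !mevalZ mevalX; congr (_ * _).
rewrite mnmE /dmon; congr (_ * _).
rewrite !big_ord_recl big_ord0 mulr1.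
rewrite !mnmBE !mnmE /pt /dexp /=.
by case: i => -[|[|[|[|//]]]] hi /=; rewrite ?subn0 ?subn1.
Qed.

Lemma quartic_meval {R : realFieldType} (K : {mpoly R[4]})  m p q s :
  K \is 4.-homog ->
  K.@[pt m p q s] = \sum_(e <- exps) K@_(mon e) *
    (m ^+ nth 0 e 0 * (p ^+ nth 0 e 1 * (q ^+ nth 0 e 2 * s ^+ nth 0 e 3))).
Proof.
move=> hK; rewrite [in LHS](quarticE K hK) !raddf_sum /=; apply: eq_bigr => e _.
rewrite !mevalZ mevalX; congr (_ * _).
by rewrite !big_ord_recl big_ord0 mulr1 !mnmE /pt /=.
Qed.

(* [c e] is the coefficient of the monomial with exponents [e]. *)
Definition coef_singular {R : realFieldType} (c : seq nat -> R) (m p q s : R) :=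
  forall i : 'I_4, \sum_(e <- exps) c e * dmon e i m p q s = 0.

(* The exponents [e] whose derivative in direction [i] survives at a point with
   zeros at the coordinates marked by [z]. *)
Definition live (i : nat) (z : seq bool) (e : seq nat) :=
  (nth 0 e i != 0)%N &&
  all (fun j => nth false z j ==> (dexp i e j == 0)%N) (iota 0 4).

(** * Rigidity: the linear equations on the coefficients of a form singular at ten points *)

Section Rigid.
Context {R : realFieldType}.
Variables (c : seq nat -> R) (a b g d : R).
Hypotheses (a0 : a != 0) (b0 : b != 0) (d0 : d != 0).

Lemma singular_sparse (z : seq bool) (i : 'I_4) m p q s :
  (forall j, nth false z j -> [:: m; p; q; s]`_j = 0) ->
  coef_singular c m p q s ->
  \sum_(e <- [seq e <- exps | live i z e]) c e * dmon e i m p q s = 0.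
Proof.
move=> hz /(_ i) E; rewrite -[RHS]E.
rewrite big_filter [RHS](bigID (live i z)) /= [X in _ = _ + X]big1 ?addr0 //.
move=> e; rewrite negb_and negbK => /orP[/eqP h|].
  by rewrite /dmon h mul0r mulr0.
have hz' j k : nth false z j && (k != 0)%N -> [:: m; p; q; s]`_j ^+ k = 0.
  by case/andP=> /hz -> /negPf k0; rewrite expr0n k0.
rewrite /dmon /= !negb_and !negb_imply !orbF.
by case/or4P=> /hz' /= ->; rewrite ?(mul0r, mulr0).
Qed.

Ltac dir z i H E :=
  have E := singular_sparse z i _ _ _ _ _ H;
  rewrite [filter _ _]/= !big_cons big_nil /dmon /dexp /= ?expr0 ?mulr1 in E;
  have {}E := E ltac:(by move=> [|[|[|[|[|?]]]]]).

Lemma eq0_of_mul (k x : R) : k != 0 -> x * k = 0 -> x = 0.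
Proof. by move=> k0 /eqP; rewrite mulf_eq0 (negPf k0) orbF => /eqP. Qed.

(** The binary quartic [k1 m^3 x + k2 m^2 x^2 + k3 m x^3 + k4 x^4] is singular at [(a, b)] and
    [(a, -b)], hence a multiple of [(b^2 m^2 - a^2 x^2)^2]; having no [m^4] term, it is zero. The
    proof separates the parts even and odd in [b]. *)
Lemma binary_eq0 (k1 k2 k3 k4 : R) :
  k3 * b ^+ 3 + 2 * k2 * a * b ^+ 2 + 3 * k1 * a ^+ 2 * b = 0 ->
  - k3 * b ^+ 3 + 2 * k2 * a * b ^+ 2 - 3 * k1 * a ^+ 2 * b = 0 ->
  4 * k4 * b ^+ 3 + 3 * k3 * a * b ^+ 2 + 2 * k2 * a ^+ 2 * b +
    k1 * a ^+ 3 = 0 ->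
  - 4 * k4 * b ^+ 3 + 3 * k3 * a * b ^+ 2 - 2 * k2 * a ^+ 2 * b +
    k1 * a ^+ 3 = 0 ->
  [/\ k1 = 0, k2 = 0, k3 = 0 & k4 = 0].
Proof.
move=> E1 E2 E3 E4.
have k20 : k2 = 0.
  by apply: (@eq0_of_mul (a * b ^+ 2)); rewrite ?mulf_neq0 ?expf_neq0 //; lra.
have k40 : k4 = 0.
  apply: (@eq0_of_mul (b ^+ 3)); first by rewrite expf_neq0.
  by rewrite k20 in E3 E4; lra.
have e1 : 3 * k1 * a ^+ 2 + k3 * b ^+ 2 = 0.
  by apply: (@eq0_of_mul b) => //; lra.
have e2 : k1 * a ^+ 2 + 3 * k3 * b ^+ 2 = 0.
  by apply: (@eq0_of_mul a) => //; rewrite k20 k40 in E3; lra.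
have k10 : k1 = 0 by apply: (@eq0_of_mul (a ^+ 2)); rewrite ?expf_neq0 //; lra.
have k30 : k3 = 0 by apply: (@eq0_of_mul (b ^+ 2)); rewrite ?expf_neq0 //; lra.
by [].
Qed.

(** Here [k1], [k2], [k3] belong to [m^2 x y], [m x^2 y], [x^3 y], and the equations are the
    [y]-derivatives at [(a, b)] and [(a, -b)] on [y = 0], the [m^3 y] term being already gone. *)
Lemma transverse_eq0 (k1 k2 k3 : R) :
  k3 * b ^+ 3 + k2 * a * b ^+ 2 + k1 * a ^+ 2 * b = 0 ->
  - k3 * b ^+ 3 + k2 * a * b ^+ 2 - k1 * a ^+ 2 * b = 0 ->
  k2 = 0 /\ k3 * b ^+ 2 = - k1 * a ^+ 2.
Proof.
move=> E1 E2; split.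
  by apply: (@eq0_of_mul (a * b ^+ 2)); rewrite ?mulf_neq0 ?expf_neq0 //; lra.
by apply/subr0_eq/(@eq0_of_mul b) => //; lra.
Qed.

(* [k], [l1], [l2], [n] are the coefficients of m^2pq, p^3q, pq^3, pqs^2, which
   share one character of the sign changes.  [g] may vanish, so [k * g = 0] alone does
   not give [k = 0]. *)
Lemma pair_eq0 (k l1 l2 n : R) :
  l1 * b ^+ 2 = - k * a ^+ 2 -> l2 * b ^+ 2 = - k * a ^+ 2 ->
  k * g * d ^+ 2 = 0 -> n * d ^+ 3 = 0 ->
  k * g ^+ 2 * d + 3 * l1 * d ^+ 3 + l2 * d ^+ 3 + n * d ^+ 3 = 0 ->
  [/\ k = 0, l1 = 0, l2 = 0 & n = 0].
Proof.
move=> h1 h2 e1 /(@eq0_of_mul (d ^+ 3)); rewrite expf_neq0 // => /(_ isT) n0 e2.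
have kg : k * g = 0 by apply: (@eq0_of_mul (d ^+ 2)); rewrite ?expf_neq0.
have l0 : 3 * l1 + l2 = 0.
  apply: (@eq0_of_mul (d ^+ 3)); rewrite ?expf_neq0 //.
  have: k * g * g * d = 0 by rewrite kg !mul0r.
  by move: e2; rewrite n0; lra.
(* By [h1] and [h2], [(3 * l1 + l2) * b ^+ 2] equals [- 4 * k * a ^+ 2]. *)
have k0 : k = 0.
  apply: (@eq0_of_mul (a ^+ 2)); rewrite ?expf_neq0 //.
  have: (3 * l1 + l2) * b ^+ 2 = 0 by rewrite l0 mul0r.
  by lra.
have z l : l * b ^+ 2 = - k * a ^+ 2 -> l = 0.
  by rewrite k0 oppr0 mul0r; apply: eq0_of_mul; rewrite expf_neq0.
by rewrite k0 (z _ h1) (z _ h2) n0.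
Qed.

Lemma pairwise_sum_eq0 (x y z : R) :
  x + y = 0 -> x + z = 0 -> y + z = 0 -> [/\ x = 0, y = 0 & z = 0].
Proof. by move=> h1 h2 h3; split; lra. Qed.

Hypothesis c4000 : c [:: 4; 0; 0; 0]%N = 0.
Hypothesis Hp : coef_singular c a b 0 0.
Hypothesis Hp' : coef_singular c a (- b) 0 0.
Hypothesis Hq : coef_singular c a 0 b 0.
Hypothesis Hq' : coef_singular c a 0 (- b) 0.
Hypothesis Hs : coef_singular c a 0 0 b.
Hypothesis Hs' : coef_singular c a 0 0 (- b).
Hypothesis T1 : coef_singular c g d d d.
Hypothesis T2 : coef_singular c g d (- d) (- d).
Hypothesis T3 : coef_singular c g (- d) d (- d).
Hypothesis T4 : coef_singular c g (- d) (- d) d.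

Let zp := [:: false; false; true; true].
Let zq := [:: false; true; false; true].
Let zs := [:: false; true; true; false].

(** [f x y] is the exponent list of [m^x] times the [y]-th power of the one other variable left
    nonzero. *)
Ltac axis z i H H' f :=
  let k1 := eval cbv beta in (f 3%N 1%N) in
  let k2 := eval cbv beta in (f 2%N 2%N) in
  let k3 := eval cbv beta in (f 1%N 3%N) in
  let k4 := eval cbv beta in (f 0%N 4%N) in
  let E1 := fresh in let E2 := fresh in let E3 := fresh in let E4 := fresh in
  dir z (0 : 'I_4) H E1; dir z (0 : 'I_4) H' E2;
  dir z i H E3; dir z i H' E4;
  rewrite c4000 in E1 E2;
  have [||||-> -> -> ->] := binary_eq0 (c k1) (c k2) (c k3) (c k4);
  [lra|lra|lra|lra|by []].

Lemma axis_p : [/\ c [:: 3; 1; 0; 0]%N = 0, c [:: 2; 2; 0; 0]%N = 0,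
  c [:: 1; 3; 0; 0]%N = 0 & c [:: 0; 4; 0; 0]%N = 0].
Proof. axis zp (1 : 'I_4) Hp Hp' (fun x y => [:: x; y; 0; 0]%N). Qed.

Lemma axis_q : [/\ c [:: 3; 0; 1; 0]%N = 0, c [:: 2; 0; 2; 0]%N = 0,
  c [:: 1; 0; 3; 0]%N = 0 & c [:: 0; 0; 4; 0]%N = 0].
Proof. axis zq (2 : 'I_4) Hq Hq' (fun x y => [:: x; 0; y; 0]%N). Qed.

Lemma axis_s : [/\ c [:: 3; 0; 0; 1]%N = 0, c [:: 2; 0; 0; 2]%N = 0,
  c [:: 1; 0; 0; 3]%N = 0 & c [:: 0; 0; 0; 4]%N = 0].
Proof. axis zs (3 : 'I_4) Hs Hs' (fun x y => [:: x; 0; 0; y]%N). Qed.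

Ltac transverse z i H H' h f :=
  let k1 := eval cbv beta in (f 2%N 1%N) in
  let k2 := eval cbv beta in (f 1%N 2%N) in
  let k3 := eval cbv beta in (f 0%N 3%N) in
  let E1 := fresh in let E2 := fresh in
  dir z i H E1; dir z i H' E2; rewrite h in E1 E2;
  apply: (transverse_eq0 (c k1) (c k2) (c k3)); lra.

Lemma transverse_pq :
  c [:: 1; 2; 1; 0]%N = 0 /\
  c [:: 0; 3; 1; 0]%N * b ^+ 2 = - c [:: 2; 1; 1; 0]%N * a ^+ 2.
Proof.
have [h _ _ _] := axis_q.
transverse zp (2 : 'I_4) Hp Hp' h (fun x y => [:: x; y; 1; 0]%N).
Qed.

Lemma transverse_ps :
  c [:: 1; 2; 0; 1]%N = 0 /\
  c [:: 0; 3; 0; 1]%N * b ^+ 2 = - c [:: 2; 1; 0; 1]%N * a ^+ 2.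
Proof.
have [h _ _ _] := axis_s.
transverse zp (3 : 'I_4) Hp Hp' h (fun x y => [:: x; y; 0; 1]%N).
Qed.

Lemma transverse_qp :
  c [:: 1; 1; 2; 0]%N = 0 /\
  c [:: 0; 1; 3; 0]%N * b ^+ 2 = - c [:: 2; 1; 1; 0]%N * a ^+ 2.
Proof.
have [h _ _ _] := axis_p.
transverse zq (1 : 'I_4) Hq Hq' h (fun x y => [:: x; 1; y; 0]%N).
Qed.

Lemma transverse_qs :
  c [:: 1; 0; 2; 1]%N = 0 /\
  c [:: 0; 0; 3; 1]%N * b ^+ 2 = - c [:: 2; 0; 1; 1]%N * a ^+ 2.
Proof.
have [h _ _ _] := axis_s.
transverse zq (3 : 'I_4) Hq Hq' h (fun x y => [:: x; 0; y; 1]%N).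
Qed.

Lemma transverse_sp :
  c [:: 1; 1; 0; 2]%N = 0 /\
  c [:: 0; 1; 0; 3]%N * b ^+ 2 = - c [:: 2; 1; 0; 1]%N * a ^+ 2.
Proof.
have [h _ _ _] := axis_p.
transverse zs (1 : 'I_4) Hs Hs' h (fun x y => [:: x; 1; 0; y]%N).
Qed.

Lemma transverse_sq :
  c [:: 1; 0; 1; 2]%N = 0 /\
  c [:: 0; 0; 1; 3]%N * b ^+ 2 = - c [:: 2; 0; 1; 1]%N * a ^+ 2.
Proof.
have [h _ _ _] := axis_q.
transverse zs (2 : 'I_4) Hs Hs' h (fun x y => [:: x; 0; 1; y]%N).
Qed.

(** With x, y, z distinct among p, q, s, the 16 monomials left are [m p q s], [m^2 x y], [x^3 y],
    [x^2 y^2] and [x^2 y z]. *)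
Let zeros := [:: [:: 4; 0; 0; 0];
  [:: 3; 1; 0; 0]; [:: 2; 2; 0; 0]; [:: 1; 3; 0; 0]; [:: 0; 4; 0; 0];
  [:: 3; 0; 1; 0]; [:: 2; 0; 2; 0]; [:: 1; 0; 3; 0]; [:: 0; 0; 4; 0];
  [:: 3; 0; 0; 1]; [:: 2; 0; 0; 2]; [:: 1; 0; 0; 3]; [:: 0; 0; 0; 4];
  [:: 1; 2; 1; 0]; [:: 1; 2; 0; 1]; [:: 1; 1; 2; 0]; [:: 1; 0; 2; 1];
  [:: 1; 1; 0; 2]; [:: 1; 0; 1; 2]]%N.

Lemma zerosP e : e \in zeros -> c e = 0.
Proof.
have h : all (fun e => c e == 0) zeros.
  rewrite /= c4000.
  case: axis_p => -> -> -> ->; case: axis_q => -> -> -> ->.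
  case: axis_s => -> -> -> ->; rewrite transverse_pq.1 transverse_ps.1.
  rewrite transverse_qp.1 transverse_qs.1 transverse_sp.1 transverse_sq.1.
  by rewrite eqxx.
by move=> /(allP h)/eqP.
Qed.

Lemma singular_residual (i : 'I_4) m p q s :
  coef_singular c m p q s ->
  \sum_(e <- [seq e <- exps | (e \notin zeros) && (nth 0 e i != 0)%N])
    c e * dmon e i m p q s = 0.
Proof.
move=> /(_ i) E; rewrite -[RHS]E big_filter.
rewrite [RHS](bigID (fun e => (e \notin zeros) && (nth 0 e i != 0)%N)) /=.
rewrite [X in _ = _ + X]big1 ?addr0 // => e.
rewrite negb_and !negbK => /orP[/zerosP ->|/eqP h]; first by rewrite mul0r.
by rewrite /dmon h mul0r mulr0.
Qed.

Ltac res i H E :=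
  have E := singular_residual i _ _ _ _ H;
  rewrite [filter _ _]/= !big_cons big_nil /dmon /dexp /= ?expr0 ?mulr1 in E.

Lemma coef_singular_eq0 e : e \in exps -> c e = 0.
Proof.
(* The four points differ by even sign changes of p, q, s, under which p and qs, q and ps, s and pq
   share a character. Signed sums of the four equations for one derivative isolate one character:
   the plain sum of [A1] to [A4], for instance, leaves only [m p q s]. *)
res (0 : 'I_4) T1 A1. res (0 : 'I_4) T2 A2.
res (0 : 'I_4) T3 A3. res (0 : 'I_4) T4 A4.
res (1 : 'I_4) T1 B1. res (1 : 'I_4) T2 B2.
res (1 : 'I_4) T3 B3. res (1 : 'I_4) T4 B4.
res (2 : 'I_4) T1 C1. res (2 : 'I_4) T2 C2.
res (2 : 'I_4) T3 C3. res (2 : 'I_4) T4 C4.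
res (3 : 'I_4) T1 D1. res (3 : 'I_4) T2 D2.
res (3 : 'I_4) T3 D3. res (3 : 'I_4) T4 D4.
have d3 : d ^+ 3 != 0 by rewrite expf_neq0.
have h1111 : c [:: 1; 1; 1; 1]%N = 0.
  by apply: (@eq0_of_mul (d ^+ 3)) => //; lra.
have [|||hpq hppq hpqq hpqss] := pair_eq0 _ _ _ (c [:: 0; 1; 1; 2]%N)
  transverse_pq.2 transverse_qp.2.
1-3: lra.
have [|||hps hpps hpss hpsqq] := pair_eq0 _ _ _ (c [:: 0; 1; 2; 1]%N)
  transverse_ps.2 transverse_sp.2.
1-3: lra.
have [|||hqs hqqs hqss hqspp] := pair_eq0 _ _ _ (c [:: 0; 2; 1; 1]%N)
  transverse_qs.2 transverse_sq.2.
1-3: lra.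
have h1 : c [:: 0; 2; 2; 0]%N + c [:: 0; 2; 0; 2]%N = 0.
  by apply: (@eq0_of_mul (d ^+ 3)) => //; rewrite h1111 in B1 B2 B3 B4; lra.
have h2 : c [:: 0; 2; 2; 0]%N + c [:: 0; 0; 2; 2]%N = 0.
  by apply: (@eq0_of_mul (d ^+ 3)) => //; rewrite h1111 in C1 C2 C3 C4; lra.
have h3 : c [:: 0; 2; 0; 2]%N + c [:: 0; 0; 2; 2]%N = 0.
  by apply: (@eq0_of_mul (d ^+ 3)) => //; rewrite h1111 in D1 D2 D3 D4; lra.
have [h0220 h0202 h0022] := pairwise_sum_eq0 _ _ _ h1 h2 h3.
have h : all (fun e => (e \in zeros) || (c e == 0)) exps.
  rewrite /= h1111 hpq hppq hpqq hpqss hps hpps hpss hpsqq hqs hqqs hqss hqspp.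
  by rewrite h0220 h0202 h0022 !eqxx.
by move=> /(allP h)/orP[/zerosP|/eqP].
Qed.
End Rigid.

(** * The linear change of coordinates *)

Section Comp.
Context {R : realFieldType}.

Lemma comp_mpolyK {n} (f g : n.-tuple {mpoly R[n]}) (P : {mpoly R[n]}) :
  (forall i, tnth f i \mPo g = 'X_i) -> (P \mPo f) \mPo g = P.
Proof.
move=> fg; rewrite (comp_mpolyE P) [RHS]mpolyE raddf_sum; apply: eq_bigr => m _.
rewrite /= comp_mpolyZ rmorph_prod /= mpolyXE_id; congr (_ *: _).
by apply: eq_bigr => i _; rewrite rmorphXn /= fg.
Qed.

Lemma dhomog_comp {n d} (f : n.-tuple {mpoly R[n]}) (P : {mpoly R[n]}) :
  (forall i, tnth f i \is 1.-homog) -> P \is d.-homog -> P \mPo f \is d.-homog.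
Proof.
move=> hf hP; rewrite comp_mpolyE big_seq; apply: rpred_sum => m hm.
apply: rpredZ; rewrite -(dhomog_mf hP hm) /= mdegE.
elim/big_rec2: _ => [|i k A _ IH]; first exact: dhomog1.
by apply: dhomogM => //; have := dhomogMn (m i) (hf i); rewrite mul1n.
Qed.

(** The sign matrix squares to 4 times the identity, so scale [4^-1] inverts scale [1]. *)
Definition hadamard (k : R) : 4.-tuple {mpoly R[4]} :=
  [tuple k *: ('X_0 + 'X_1 + 'X_2 + 'X_3); k *: ('X_0 + 'X_1 - 'X_2 - 'X_3);
    k *: ('X_0 - 'X_1 + 'X_2 - 'X_3); k *: ('X_0 - 'X_1 - 'X_2 + 'X_3)].

Lemma tnth4_ind (T : Type) (a b c d : T) (i : 'I_4) (P : 'I_4 -> T -> Prop) :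
  P 0 a -> P 1 b -> P 2 c -> P 3 d -> P i (tnth [tuple a; b; c; d] i).
Proof.
move=> ha hb hc hd; rewrite (tnth_nth a).
case: i => -[|[|[|[|//]]]] h /=.
- by rewrite (_ : Ordinal h = 0) //; apply/val_inj.
- by rewrite (_ : Ordinal h = 1) //; apply/val_inj.
- by rewrite (_ : Ordinal h = 2) //; apply/val_inj.
- by rewrite (_ : Ordinal h = 3) //; apply/val_inj.
Qed.

Lemma hadamard_homog k i : tnth (hadamard k) i \is 1.-homog.
Proof.
have hX j : ('X_j : {mpoly R[4]}) \is 1.-homog by rewrite dhomogX /= mdeg1.
apply: (@tnth4_ind _ _ _ _ _ i (fun _ x => x \is 1.-homog)); apply: rpredZ.
all: do ?[exact: hX | apply: rpredD | rewrite rpredN].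
Qed.

Lemma hadamardK i : tnth (hadamard 1) i \mPo hadamard 4^-1 = 'X_i.
Proof.
have hX j : 'X_j \mPo hadamard 4^-1 = tnth (hadamard 4^-1) j.
  by rewrite comp_mpolyXU (tnth_nth 0).
apply: (@tnth4_ind _ _ _ _ _ i (fun i x => x \mPo hadamard 4^-1 = 'X_i)).
all: rewrite scale1r !(comp_mpolyD, comp_mpolyN, hX) !(tnth_nth 0) /=.
all: have h4 : (4^-1)%:MP * 4 = 1 :> {mpoly R[4]}
  by rewrite -[4]/(4%:R) -(mpolyC_nat _ R 4) -mpolyCM mulVf ?pnatr_eq0.
all: by rewrite -!mul_mpolyC -[RHS]mul1r -h4; ring.
Qed.

Lemma hadamard_inj (P : {mpoly R[4]}) : P \mPo hadamard 1 = 0 -> P = 0.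
Proof. by move=> h; rewrite -(comp_mpolyK _ _ P hadamardK) h comp_mpoly0. Qed.

Lemma meval_hadamard (P : {mpoly R[4]}) m p q s :
  (P \mPo hadamard 1).@[pt m p q s] =
  P.@[pt (m + p + q + s) (m + p - q - s) (m - p + q - s) (m - p - q + s)].
Proof.
rewrite comp_mpoly_meval; apply: meval_eq => i.
apply: (@tnth4_ind _ _ _ _ _ i (fun i x => x.@[_] = _)).
all: by rewrite scale1r !(mevalD, mevalN, mevalXU).
Qed.
End Comp.

(** * Evaluation of the symmetric quartics *)

Ltac expand_sums T :=
  rewrite /T; under eq_bigr do rewrite big_mkcond;
  rewrite !(big_ord_recl, big_ord0) -?val_eqE /=;
  rewrite !(mevalD, mevalM, meval0, rmorphXn, mevalXU) /= /pt /=; ring.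

Section Eval.
Variable R : realType.
Variables a b c d : R.
Local Notation v := (pt a b c d).

Lemma meval_abcd : (abcd R).@[v] = a * b * c * d.
Proof.
rewrite /abcd !big_ord_recr big_ord0 /= mul1r !mevalM !mevalXU /pt //=.
Qed.

Lemma meval_s0 : (s0 R).@[v] =
  a ^+ 4 + b ^+ 4 + c ^+ 4 + d ^+ 4 - 4 * (a * b * c * d).
Proof.
rewrite /s0 mevalB mevalZ meval_abcd; congr (_ - _).
by rewrite !big_ord_recr big_ord0 /= add0r !mevalD !rmorphXn /= !mevalXU.
Qed.

Lemma meval_s1 : (s1 R).@[v] =
  a ^+ 3 * (b + c + d) + b ^+ 3 * (a + c + d) + c ^+ 3 * (a + b + d) +
  d ^+ 3 * (a + b + c) - 12 * (a * b * c * d).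
Proof.
rewrite /s1 mevalB mevalZ meval_abcd; congr (_ - _).
expand_sums T31.
Qed.

Lemma meval_s2 : (s2 R).@[v] =
  a ^+ 2 * (b ^+ 2 + c ^+ 2 + d ^+ 2) + b ^+ 2 * (c ^+ 2 + d ^+ 2) +
  c ^+ 2 * d ^+ 2 - 6 * (a * b * c * d).
Proof.
rewrite /s2 mevalB mevalZ meval_abcd; congr (_ - _).
expand_sums T22.
Qed.

Lemma meval_s3 : (s3 R).@[v] =
  a ^+ 2 * (b * c + b * d + c * d) + b ^+ 2 * (a * c + a * d + c * d) +
  c ^+ 2 * (a * b + a * d + b * d) + d ^+ 2 * (a * b + a * c + b * c)
  - 12 * (a * b * c * d).
Proof.
rewrite /s3 mevalB mevalZ meval_abcd; congr (_ - _).
rewrite /T211.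
under eq_bigr do under eq_bigr do rewrite big_mkcond.
rewrite !(big_ord_recl, big_ord0).
rewrite -!val_eqE /=.
rewrite !(mevalD, mevalM, meval0, rmorphXn, mevalXU) /= /pt /=; ring.
Qed.
End Eval.

(** * Homogeneity *)

Section Homog.
Variable R : realType.

Lemma xv_homog i : xv R i \is 1.-homog.
Proof. by rewrite dhomogX /= mdeg1. Qed.

Lemma xvX_homog k i : xv R i ^+ k \is k.-homog.
Proof. by have := dhomogMn k (xv_homog i); rewrite mul1n. Qed.

Lemma abcd_homog : abcd R \is 4.-homog.
Proof.
rewrite /abcd !big_ord_recr big_ord0 /= mul1r.
do 3![rewrite -[X in X.-homog]addn1; apply: dhomogM; last exact: xv_homog].
exact: xv_homog.
Qed.

Lemma s0_homog : s0 R \is 4.-homog.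
Proof.
apply: rpredB; last by apply: rpredZ; exact: abcd_homog.
by apply: rpred_sum => i _; exact: xvX_homog.
Qed.

Lemma s1_homog : s1 R \is 4.-homog.
Proof.
apply: rpredB; last by apply: rpredZ; exact: abcd_homog.
apply: rpred_sum => i _; apply: rpred_sum => j _.
exact: (dhomogM (xvX_homog 3 i) (xv_homog j)).
Qed.

Lemma s2_homog : s2 R \is 4.-homog.
Proof.
apply: rpredB; last by apply: rpredZ; exact: abcd_homog.
apply: rpred_sum => i _; apply: rpred_sum => j _.
exact: (dhomogM (xvX_homog 2 i) (xvX_homog 2 j)).
Qed.

Lemma s3_homog : s3 R \is 4.-homog.
Proof.
apply: rpredB; last by apply: rpredZ; exact: abcd_homog.
apply: rpred_sum => i _; apply: (dhomogM (xvX_homog 2 i)).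
apply: rpred_sum => j _; apply: rpred_sum => k _.
exact: (dhomogM (xv_homog j) (xv_homog k)).
Qed.

Lemma gtu_homog (t u : R) : gtu t u \is 4.-homog.
Proof.
rewrite /gtu; apply: rpredZ.
do !apply: rpredD; apply: rpredZ;
 [exact: s0_homog | exact: s1_homog | exact: s2_homog | exact: s3_homog
 |exact: abcd_homog].
Qed.

End Homog.

(** * Nonnegativity through the triangle of [(pqs, N)] *)

Section PSD.
Context {R : rcfType}.

(** Applied to the squares of p, q, s it gives [3 N <= S^2]; applied to their pairwise products it
    gives [3 S (pqs)^2 <= N^2]. *)
Lemma three_sumM_le_sqr (x y z : R) :
  3 * (x * y + x * z + y * z) <= (x + y + z) ^+ 2.
Proof.
rewrite -subr_ge0.
have -> : (x + y + z) ^+ 2 - 3 * (x * y + x * z + y * z) =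
  2^-1 * ((x - y) ^+ 2 + (x - z) ^+ 2 + (y - z) ^+ 2) by field.
by rewrite mulr_ge0 ?invr_ge0 ?addr_ge0 ?sqr_ge0 ?ler0n.
Qed.

(* [k (A S - B m^2)^2 + e m pqs + f N] in the notation of the header. *)
Definition tetra (k A B e f m p q s : R) : R :=
  k * (A * (p ^+ 2 + q ^+ 2 + s ^+ 2) - B * m ^+ 2) ^+ 2 + e * m * (p * q * s) +
  f * (p ^+ 2 * q ^+ 2 + p ^+ 2 * s ^+ 2 + q ^+ 2 * s ^+ 2).

Lemma tetra_ge0 (k A B e f : R) : 0 <= k ->
  (forall m v, 0 <= tetra k A B e f m v v v) ->
  forall m p q s, 0 <= tetra k A B e f m p q s.
Proof.
move=> k0 diag m p q s.
pose S := p ^+ 2 + q ^+ 2 + s ^+ 2.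
pose N := p ^+ 2 * q ^+ 2 + p ^+ 2 * s ^+ 2 + q ^+ 2 * s ^+ 2.
have S0 : 0 <= S by rewrite !addr_ge0 ?sqr_ge0.
have N0 : 0 <= N by do ?[exact: sqr_ge0 | apply: addr_ge0 | apply: mulr_ge0].
pose v := Num.sqrt (S / 3).
have v2 : v ^+ 2 = S / 3 by rewrite sqr_sqrtr // divr_ge0.
have hS : S = 3 * v ^+ 2 by rewrite v2; field.
have hN : N <= 3 * v ^+ 4.
  have := three_sumM_le_sqr (p ^+ 2) (q ^+ 2) (s ^+ 2).
  rewrite -/S -/N hS; lra.
have hpqs : `|3 * v * (p * q * s)| <= N.
  rewrite -(@ler_pXn2r _ 2) ?nnegrE ?normr_ge0 // real_normK ?num_real //.
  apply: le_trans
    (three_sumM_le_sqr (p ^+ 2 * q ^+ 2) (p ^+ 2 * s ^+ 2) (q ^+ 2 * s ^+ 2)).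
  rewrite le_eqVlt; apply/orP; left; apply/eqP.
  transitivity (9 * v ^+ 2 * (p * q * s) ^+ 2); first by ring.
  by rewrite v2 /S; field.
(* For [v = 0] the triangle shrinks to a point and the weights below all vanish. *)
have [v0|v0] := eqVneq v 0.
  have S00 : S = 0 by rewrite hS v0 expr0n mulr0.
  have p0 : p = 0.
    apply/eqP; rewrite -sqrf_eq0 eq_le sqr_ge0 andbT -S00 /S -addrA lerDl.
    by rewrite addr_ge0 ?sqr_ge0.
  have N00 : N = 0.
    apply/eqP; rewrite eq_le N0 andbT; move: hN; by rewrite v0 expr0n mulr0.
  rewrite /tetra -/S -/N S00 N00 p0 !mul0r !mulr0 !addr0.
  by rewrite mulr_ge0 ?sqr_ge0.
have v4 : 0 < 3 * v ^+ 4.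
  have -> : v ^+ 4 = (v ^+ 2) ^+ 2 by ring.
  by rewrite mulr_gt0 // lt0r sqr_ge0 andbT !sqrf_eq0.
rewrite -(pmulr_rge0 _ v4).
(* Barycentric coordinates of [(pqs, N)], scaled by [3 * v ^+ 4]; the first vertex has
   [pqs = N = 0]. *)
have -> : 3 * v ^+ 4 * tetra k A B e f m p q s =
  (3 * v ^+ 4 - N) * (k * (A * (3 * v ^+ 2) - B * m ^+ 2) ^+ 2) +
  2^-1 * (N + 3 * v * (p * q * s)) * tetra k A B e f m v v v +
  2^-1 * (N - 3 * v * (p * q * s)) * tetra k A B e f m (- v) (- v) (- v).
  by rewrite /tetra -/S -/N hS; field.
move: hpqs; rewrite ler_norml => /andP[h1 h2].
have h0 : 0 <= 3 * v ^+ 4 - N by rewrite subr_ge0.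
have hp : 0 <= 2^-1 * (N + 3 * v * (p * q * s)) by lra.
have hm : 0 <= 2^-1 * (N - 3 * v * (p * q * s)) by lra.
by rewrite addr_ge0 ?addr_ge0 // mulr_ge0 ?diag // mulr_ge0 ?sqr_ge0.
Qed.

End PSD.

(** * The binary form on the points [(x, y, y, y)] *)

Section Restrict.
Context {R : realType}.

(* The cofactor of [u^2 (x - t y)^2] in g_{t,u}(x,y,y,y). *)
Definition cusp_form (t w x y : R) : R :=
  pG0 t w * x ^+ 2 + (3 * pG1 t w + 2 * t * pG0 t w) * x * y +
  (6 * w ^+ 2 - 3 * (t - 1) ^+ 2 * w) * y ^+ 2.

(** Completing the square in [y] leaves a discriminant with factor [VF t w], whose positivity also
    makes the [y^2] coefficient positive. *)
Lemma cusp_form_ge0 (t w x y : R) : 0 < VF t w -> 0 <= cusp_form t w x y.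
Proof.
move=> hV.
set c := 6 * w ^+ 2 - 3 * (t - 1) ^+ 2 * w.
have k0 : 0 <= (t - 1) ^+ 2 by rewrite sqr_ge0.
have c0 : 0 < c.
  have hV' : 0 < w * ((3 + 6 * t - t ^+ 2) * w - 6 * (t - 1) ^+ 2).
    by move: hV; rewrite /VF; lra.
  have -> : c = 3 * (w * (2 * w - (t - 1) ^+ 2)) by rewrite /c; ring.
  rewrite pmulr_rgt0 //.
  case: (ltgtP w 0) => hw; last by move: hV'; rewrite hw mul0r ltxx.
    rewrite nmulr_rgt0 //; lra.
  move: hV'; rewrite !pmulr_rgt0 // => h.
  (* Since [(3 + 6 t - t^2) + (t - 3)^2 = 12], adding this to [h] gives [2 w > (t - 1)^2]. *)
  have : 0 <= (t - 3) ^+ 2 * w by rewrite mulr_ge0 ?sqr_ge0 // ltW.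
  lra.
rewrite -(pmulr_rge0 _ c0).
have -> : c * cusp_form t w x y =
  (c * y + 2^-1 * (3 * pG1 t w + 2 * t * pG0 t w) * x) ^+ 2 +
  w ^+ 2 * (t - 1) ^+ 2 * VF t w * x ^+ 2.
  by rewrite /cusp_form /c /VF /pG0 /pG1; field.
by do ?[exact: sqr_ge0 | exact: ltW | apply: addr_ge0 | apply: mulr_ge0].
Qed.
End Restrict.

Definition singular_at {R : realFieldType} (K : {mpoly R[4]}) (v : 'I_4 -> R) :=
  forall i, (K^`M(i)).@[v] = 0.

(** For [a = u + 1], [b = u - 1], [g = t + 3], [d = t - 1] the ten points are, up to scaling, the
    permutations of [(u,u,1,1)] and [(t,1,1,1)]. *)
Lemma quartic_rigid {R : realFieldType} (K : {mpoly R[4]}) (a b g d : R) :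
  a != 0 -> b != 0 -> d != 0 -> K \is 4.-homog ->
  K.@[pt 1 0 0 0] = 0 ->
  singular_at K (pt a b 0 0) -> singular_at K (pt a (- b) 0 0) ->
  singular_at K (pt a 0 b 0) -> singular_at K (pt a 0 (- b) 0) ->
  singular_at K (pt a 0 0 b) -> singular_at K (pt a 0 0 (- b)) ->
  singular_at K (pt g d d d) -> singular_at K (pt g d (- d) (- d)) ->
  singular_at K (pt g (- d) d (- d)) -> singular_at K (pt g (- d) (- d) d) ->
  K = 0.
Proof.
move=> a0 b0 d0 hK K0 Hp Hp' Hq Hq' Hs Hs' T1 T2 T3 T4.
have sing m p q s : singular_at K (pt m p q s) ->
    coef_singular (fun e => K@_(mon e)) m p q s.
  by move=> h i; rewrite -quartic_mderiv // h.
(* The value at [(1,0,0,0)] is the coefficient of [m^4]. *)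
have c4000 : K@_(mon [:: 4; 0; 0; 0]%N) = 0.
  move: K0; rewrite quartic_meval // (bigD1_seq [:: 4; 0; 0; 0]%N) //=.
  rewrite big_seq_cond !expr0 !mulr1 expr1n mulr1 big1 ?addr0 // => e.
  have /allP all0 : all (fun e => (e == [:: 4; 0; 0; 0]%N) ||
      has (fun j => nth 0 e j != 0)%N [:: 1; 2; 3]%N) exps by [].
  move=> /andP[/all0 + /negPf ne]; rewrite ne /= orbF.
  by case/or3P => h; rewrite !expr0n (negPf h) ?(mul0r, mulr0).
rewrite (quarticE K hK) big_seq big1 // => e he.
have := coef_singular_eq0 (fun e => K@_(mon e)) a b g d a0 b0 d0 c4000.
move/(_ (sing _ _ _ _ Hp) (sing _ _ _ _ Hp') (sing _ _ _ _ Hq)).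
move/(_ (sing _ _ _ _ Hq') (sing _ _ _ _ Hs) (sing _ _ _ _ Hs')).
move/(_ (sing _ _ _ _ T1) (sing _ _ _ _ T2) (sing _ _ _ _ T3)).
by move/(_ (sing _ _ _ _ T4) e he) => ->; rewrite scale0r.
Qed.

(** * Application to g_{t,u} *)

Section Main.
Variable R : realType.
Variables t u : R.
Hypotheses (t1 : t != 1) (u0 : u != 0) (u1 : u != 1) (uN1 : u != -1).
Hypothesis hV : 0 < VF t (omega u).

Local Notation w := (omega u).
Local Notation G := (gtu t u \mPo hadamard 1).

Lemma meval_gtu (x : 'I_4 -> R) : (gtu t u).@[x] = u ^+ 2 *
  (pG0 t w * (s0 R).@[x] + pG1 t w * (s1 R).@[x] + pG2 t w * (s2 R).@[x] +
   pG3 t w * (s3 R).@[x] + pG4 t w * (s4 R).@[x]).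
Proof. by rewrite /gtu !(mevalD, mevalZ). Qed.

Definition pqs_coef := u ^+ 2 * (64 * pG0 t w -
  96 * (pG1 t w + pG2 t w + pG3 t w) + 8 * pG4 t w).
Definition N_coef := u ^+ 2 * (32 * pG0 t w + 32 * pG1 t w +
  16 * pG2 t w + 64 * pG3 t w - 4 * pG4 t w).

Lemma gtu_tetra m p q s : G.@[pt m p q s] =
  tetra (2 * (t - 1) ^+ 4) ((u + 1) ^+ 2) ((u - 1) ^+ 2) pqs_coef N_coef
    m p q s.
Proof.
rewrite meval_hadamard meval_gtu meval_s0 meval_s1 meval_s2 meval_s3 meval_abcd.
set S := p ^+ 2 + q ^+ 2 + s ^+ 2.
(* This expansion holds for arbitrary values of the [pG]; their definitions and [u w = (u - 1)^2]
   then turn the first three terms into a square. *)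
transitivity (u ^+ 2 * pG4 t w * m ^+ 4
  + u ^+ 2 * (32 * pG0 t w + 48 * pG1 t w + 16 * pG2 t w + 16 * pG3 t w -
      2 * pG4 t w) * m ^+ 2 * S
  + u ^+ 2 * (pG4 t w - 16 * pG1 t w - 16 * pG3 t w) * S ^+ 2
  + pqs_coef * m * (p * q * s)
  + N_coef * (p ^+ 2 * q ^+ 2 + p ^+ 2 * s ^+ 2 + q ^+ 2 * s ^+ 2)).
  rewrite /pqs_coef /N_coef /S.
  move: (pG0 t w) (pG1 t w) (pG2 t w) (pG3 t w) (pG4 t w) => p0 p1 p2 p3 p4.
  ring.
rewrite /tetra -/S; congr (_ + _ + _).
rewrite /pG0 /pG1 /pG2 /pG3 /pG4 /omega; field.
exact: u0.
Qed.

Lemma gtu_cusp m v : G.@[pt m v v v] =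
  u ^+ 2 * (m + 3 * v - t * (m - v)) ^+ 2 * cusp_form t w (m + 3 * v) (m - v).
Proof.
rewrite meval_hadamard meval_gtu meval_s0 meval_s1 meval_s2 meval_s3 meval_abcd.
rewrite /cusp_form /pG0 /pG1 /pG2 /pG3 /pG4; move: w => W; ring.
Qed.

Lemma gtu_hadamard_ge0 m p q s : 0 <= G.@[pt m p q s].
Proof.
rewrite gtu_tetra; apply: tetra_ge0.
  by rewrite mulr_ge0 // (_ : 4 = 2 * 2)%N // exprM sqr_ge0.
move=> n v; rewrite -gtu_tetra gtu_cusp.
by rewrite mulr_ge0 ?cusp_form_ge0 // mulr_ge0 ?sqr_ge0.
Qed.

Lemma pt_eta (x : 'I_4 -> R) : x =1 pt (x 0) (x 1) (x 2) (x 3).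
Proof.
by case=> -[|[|[|[|//]]]] h; rewrite /pt /=; congr (x _); apply/val_inj.
Qed.

Lemma hadamard_surj (x : 'I_4 -> R) : exists m p q s, forall P : {mpoly R[4]},
  P.@[x] = (P \mPo hadamard 1).@[pt m p q s].
Proof.
exists ((x 0 + x 1 + x 2 + x 3) / 4), ((x 0 + x 1 - x 2 - x 3) / 4),
  ((x 0 - x 1 + x 2 - x 3) / 4), ((x 0 - x 1 - x 2 + x 3) / 4) => P.
rewrite meval_hadamard (meval_eq _ (pt_eta x)); apply: meval_eq => i.
by congr (pt _ _ _ _ i); field.
Qed.

Lemma gtu_P44 : P44 (gtu t u).
Proof.
split; first exact: gtu_homog.
move=> x; have [m [p [q [s ->]]]] := hadamard_surj x.
exact: gtu_hadamard_ge0.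
Qed.

Lemma gtu_ones_gt0 : 0 < G.@[pt 1 0 0 0].
Proof.
rewrite gtu_tetra /tetra.
have -> : 2 * (t - 1) ^+ 4 *
  ((u + 1) ^+ 2 * (0 ^+ 2 + 0 ^+ 2 + 0 ^+ 2) - (u - 1) ^+ 2 * 1 ^+ 2) ^+ 2 +
  pqs_coef * 1 * (0 * 0 * 0) +
  N_coef * (0 ^+ 2 * 0 ^+ 2 + 0 ^+ 2 * 0 ^+ 2 + 0 ^+ 2 * 0 ^+ 2) =
  2 * ((t - 1) ^+ 2 * (u - 1) ^+ 2) ^+ 2 by ring.
rewrite mulr_gt0 // lt0r sqr_ge0 andbT expf_neq0 //.
by rewrite mulf_neq0 // expf_neq0 // subr_eq0.
Qed.

(** The square in [tetra] vanishes by the choice of S, the other terms by the pairwise products. *)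
Lemma gtu_axis p q s : p ^+ 2 + q ^+ 2 + s ^+ 2 = (u - 1) ^+ 2 ->
  p * q = 0 -> p * s = 0 -> q * s = 0 -> G.@[pt (u + 1) p q s] = 0.
Proof.
move=> h pq ps qs; rewrite gtu_tetra /tetra h -!exprMn pq ps qs; ring.
Qed.

(** [tetra] sees p, q, s only through their squares and product, so one point suffices; there
    [x = 4 t] and [y = 4] make [x - t y] vanish. *)
Lemma gtu_tetrahedron p q s :
  p ^+ 2 = (t - 1) ^+ 2 -> q ^+ 2 = (t - 1) ^+ 2 -> s ^+ 2 = (t - 1) ^+ 2 ->
  p * q * s = (t - 1) ^+ 3 -> G.@[pt (t + 3) p q s] = 0.
Proof.
move=> hp hq hs hpqs.
transitivity (G.@[pt (t + 3) (t - 1) (t - 1) (t - 1)]); last first.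
  by rewrite gtu_cusp; ring.
by rewrite !gtu_tetra /tetra hp hq hs hpqs; ring.
Qed.

Lemma summand_proportional (g h : {mpoly R[4]}) :
  P44 g -> P44 h -> gtu t u = g + h -> exists2 c, 0 <= c & g = c *: gtu t u.
Proof.
move=> [hg g0] [_ h0] e.
(* Chosen so that the difference vanishes at [(1,0,0,0)], which corresponds to [(1,1,1,1)]. *)
pose c := (g \mPo hadamard 1).@[pt 1 0 0 0] / G.@[pt 1 0 0 0].
have c0 : 0 <= c by rewrite divr_ge0 ?gtu_hadamard_ge0 // meval_hadamard.
exists c => //; apply/subr0_eq/hadamard_inj.
have sing m p q s : G.@[pt m p q s] = 0 ->
    singular_at ((g - c *: gtu t u) \mPo hadamard 1) (pt m p q s).
  move=> Gz i; rewrite comp_mpolyB comp_mpolyZ mderivB mderivZ mevalB mevalZ.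
  have ge0 (P : {mpoly R[4]}) : (forall x, 0 <= P.@[x]) ->
      forall x, 0 <= (P \mPo hadamard 1).@[x].
    by move=> P0 x; rewrite (meval_eq _ (pt_eta x)) meval_hadamard.
  (* Both summands are nonnegative, so each vanishes where [G] does. *)
  have gz : (g \mPo hadamard 1).@[pt m p q s] = 0.
    apply/eqP; rewrite eq_le (ge0 _ g0) andbT -Gz e comp_mpolyD mevalD lerDl.
    exact: ge0.
  rewrite (singular_of_ge0 (g \mPo hadamard 1) _ (ge0 _ g0) gz).
  by rewrite (singular_of_ge0 G _ (ge0 _ gtu_P44.2) Gz) mulr0 subr0.
have a0 : u + 1 != 0 by rewrite -[1]opprK subr_eq0.
have b0 : u - 1 != 0 by rewrite subr_eq0.
have d0 : t - 1 != 0 by rewrite subr_eq0.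
apply: (quartic_rigid _ (u + 1) (u - 1) (t + 3) (t - 1)) => //.
- apply: dhomog_comp => [i|]; first exact: hadamard_homog.
  by apply: rpredB => //; apply: rpredZ; exact: gtu_homog.
- rewrite comp_mpolyB comp_mpolyZ mevalB mevalZ divfK ?subrr //.
  by rewrite gt_eqF ?gtu_ones_gt0.
all: apply: sing; first [apply: gtu_axis | apply: gtu_tetrahedron]; ring.
Qed.

End Main.

Theorem theorem2p5 (R : realType) (t u : R) :
  t != 0 -> t != 1 ->
  u != 0 -> u != 1 -> u != -1 ->
  2 * u != t + 1 ->
  t * u + u != 2 ->
  DF t u != 0 ->
  0 < VF t (omega u) ->
  extremal_P44 (gtu t u).
Proof.
move=> _ t1 u0 u1 uN1 _ _ _ hV; split.
- exact: gtu_P44.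
- apply/eqP => h; have := gtu_ones_gt0 R t u t1 u0 u1.
  by rewrite h comp_mpoly0 meval0 ltxx.
- move=> g h hg hh e; split.
    exact: (@summand_proportional _ _ _ _ _ _ _ _ g h).
  by apply: (@summand_proportional _ _ _ _ _ _ _ _ h g) => //; rewrite addrC.
Qed.
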